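(* For any planar non-collinear four-body central configuration, the matrix $\widetilde L=\ell\otimes\mathbf I_2$ has exactly two non-zero eigenvalues (counted with multiplicity), both equal to $$\tau:=\operatorname{tr}(\ell)=\alpha_{12}^\perp+\alpha_{13}^\perp+\alpha_{14}^\perp+2(\alpha_{23}^\perp+\alpha_{24}^\perp+\alpha_{34}^\perp).$$ In particular, $\operatorname{spec}(\widetilde L)=\{\tau,\tau,0,0,0,0\}$.
   Context: Four bodies have masses $m_1,\dots,m_4>0$, $M=\sum_i m_i$, pairwise distinct positions $\mathbf r_i\in\mathbb R^2$ with $\sum_i m_i\mathbf r_i=0$; $\mathbf q_{ij}=\mathbf r_i-\mathbf r_j$, $q_{ij}=|\mathbf q_{ij}|$, $\mu_{ij}=m_im_j/M$. The configuration is central if there is $\omega^2>0$ with $\omega^2m_i\mathbf r_i=\sum_{j\ne i}\frac{m_im_j}{q_{ij}^3}\mathbf q_{ij}$ for all $i$ (such $\omega^2$ is then uniquely determined). It is non-collinear if the four positions do not lie on one line. Put $\alpha_{ij}^\perp=\alpha_{ji}^\perp=\mu_{ij}(\omega^2-M/q_{ij}^3)$. The reduced transverse Laplacian $\ell\in\mathbb R^{3\times3}$ has entries indexed by bodies $a,b\in\{2,3,4\}$: $\ell_{a-1,a-1}=\sum_{k\ne a}\alpha_{ak}^\perp$ (sum over $k\in\{1,2,3,4\}$, $k\neq a$) and $\ell_{a-1,b-1}=-\alpha_{ab}^\perp$ for $a\neq b$. $\operatorname{spec}$ denotes the spectrum as a multiset. *)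

(* Defs.v *)
From HB Require Import structures.
From mathcomp Require Import all_boot all_order all_algebra.
From mathcomp Require Import reals complex mxtens.

Set Implicit Arguments.
Unset Strict Implicit.
Unset Printing Implicit Defensive.

Import Order.TTheory GRing.Theory Num.Theory.
Local Open Scope ring_scope.
Local Open Scope complex_scope.

(* The bodies 1, 2, 3, 4 are the elements 0, 1, 2, 3 of 'I_4. *)

Section CentralConfigurations.
Variable R : realType.
Implicit Types (m : 'I_4 -> R) (r : 'I_4 -> 'rV[R]_2) (wsq : R).

(* The norm provided by MathComp-Analysis on matrices is the sup norm. *)
Definition euclidean_norm (v : 'rV[R]_2) : R := Num.sqrt (\sum_k v 0 k ^+ 2).

Definition dist r (i j : 'I_4) : R := euclidean_norm (r i - r j).

Definition total_mass m : R := \sum_i m i.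

(* wsq stands for omega^2. *)
Definition central_configuration m r wsq : Prop :=
  0 < wsq /\
  forall i, (wsq * m i) *: r i =
    \sum_(j | j != i) (m i * m j / dist r i j ^+ 3) *: (r i - r j).

Definition collinear r : Prop :=
  exists p d : 'rV[R]_2, d != 0 /\ forall i, exists t : R, r i = p + t *: d.

Definition reduced_mass m (i j : 'I_4) : R := m i * m j / total_mass m.

Definition alpha_perp m r wsq (i j : 'I_4) : R :=
  reduced_mass m i j * (wsq - total_mass m / dist r i j ^+ 3).

(* Row and column i : 'I_3 correspond to the body lift ord0 i, i.e. to the
   nonzero element i.+1 of 'I_4: body 1 is the one left out. *)
Definition reduced_laplacian m r wsq : 'M[R]_3 :=
  \matrix_(i, j)
    let a := lift ord0 i in
    let b := lift ord0 j in
    if i == j then \sum_(k | k != a) alpha_perp m r wsq a k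
    else - alpha_perp m r wsq a b.

End CentralConfigurations.

(* The complex eigenvalues of a real square matrix, listed with algebraic
   multiplicity in an unspecified order: compare up to perm_eq. *)
Definition spectrum (R : realType) n (A : 'M[R]_n) : seq R[i] :=
  sval (closed_field_poly_normal (char_poly (map_mx (real_complex R) A))).

Lemma spectrumP (R : realType) n (A : 'M[R]_n) :
  char_poly (map_mx (real_complex R) A) =
  \prod_(z <- spectrum A) ('X - z%:P).
Proof.
rewrite /spectrum; case: closed_field_poly_normal => s /= {1}->.
by rewrite (monicP (char_poly_monic _)) scale1r.
Qed.

(* Main.v *)
(* The Laplacian of the weights alpha_perp annihilates constants and, by
   centrality, both coordinate functions. So ell kills the 3 x 2 matrix of
   positions relative to body 1, which has rank 2 by non-collinearity, and ell
   has rank at most 1. Being symmetric, ell is nilpotent only if it vanishes;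
   that would make all mutual distances equal, impossible for four points in a
   plane. Hence tau <> 0. For ell = u v the matrix ell (x) 1 = (u (x) 1)(v (x) 1)
   has the same non-zero spectrum as (v (x) 1)(u (x) 1), the scalar matrix tau
   of size 2. *)
Require Import Defs.
From HB Require Import structures.
From mathcomp Require Import all_boot all_order all_algebra.
From mathcomp Require Import reals complex mxtens.
From mathcomp Require Import ring lra.

Set Implicit Arguments.
Unset Strict Implicit.
Unset Printing Implicit Defensive.

Import Order.TTheory GRing.Theory Num.Theory.
Local Open Scope ring_scope.
Local Open Scope complex_scope.

(** * Characteristic polynomials and rank-one matrices *)

Lemma char_poly_scalar (R : comNzRingType) n (a : R) :
  char_poly (a%:M : 'M[R]_n) = ('X - a%:P) ^+ n.
Proof.
by rewrite /char_poly /char_poly_mx map_scalar_mx -raddfB /= det_scalar.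
Qed.

(* Both sides are ['X^k * \det M] for M the block matrix with rows ['X, A] and
   [B, 1]. *)
Lemma char_poly_mulmxC (R : comNzRingType) n k
    (A : 'M[R]_(n, k)) (B : 'M[R]_(k, n)) :
  char_poly (A *m B) * 'X^k = char_poly (B *m A) * 'X^n.
Proof.
pose A' := map_mx polyC A; pose B' := map_mx polyC B.
pose M : 'M_(n + k) := block_mx 'X%:M A' B' 1%:M.
have detM : \det M = char_poly (A *m B).
  have : \det (M *m block_mx 1%:M 0 (- B') 1%:M) = char_poly (A *m B).
    rewrite mulmx_block !mulmx1 !mul1mx !mulmx0 !add0r subrr mulmxN.
    by rewrite det_ublock det1 mulr1 /char_poly /char_poly_mx map_mxM.
  by rewrite det_mulmx det_lblock !det1 !mulr1.
have : \det (block_mx 1%:M 0 (- B') 'X%:M *m M) = char_poly (B *m A) * 'X^n.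
  rewrite mulmx_block !mul1mx !mul0mx !addr0 mulmx1 mul_mx_scalar mul_scalar_mx.
  rewrite scalerN addNr det_ublock det_scalar mulrC; congr (_ * _).
  by rewrite /char_poly /char_poly_mx map_mxM mulNmx addrC.
by rewrite det_mulmx det_lblock det1 mul1r det_scalar detM mulrC.
Qed.

(** The factor ['X^k] stays on the left to avoid the truncated exponent [n * k - k]. *)
Lemma char_poly_rank1_tens1 (R : idomainType) n k (u : 'cV[R]_n) (v : 'rV[R]_n) :
  char_poly ((u *m v) *t (1%:M : 'M_k)) * 'X^k =
  ('X - (\tr (u *m v))%:P) ^+ k * 'X^(n * k).
Proof.
have := char_poly_mulmxC (u *t (1%:M : 'M_k)) (v *t (1%:M : 'M_k)).
rewrite !tensmx_mul !mulmx1.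
have -> : v *m u = (\tr (u *m v))%:M by rewrite mxtrace_mulC trace_mx11 -mx11_scalar.
rewrite tens_scalar_mx scalemx1.
have -> : castmx (esym (mul1n k), esym (mul1n k)) (\tr (u *m v))%:M =
   (\tr (u *m v))%:M :> 'M[R]_(1 * k).
  by case: _ / (esym (mul1n k)); rewrite castmx_id.
by rewrite char_poly_scalar mul1n.
Qed.

Lemma rank_le1P (F : fieldType) n k (A : 'M[F]_(n, k)) :
  (\rank A <= 1)%N -> exists (u : 'cV_n) (v : 'rV_k), A = u *m v.
Proof.
move=> rkA; have := mulmx_base A; move: (col_base A) (row_base A).
case: (\rank A) rkA => [|[|//]] _ C B <-; last by exists C, B.
(* Rank 0: the row base [B] has no rows, so the product is zero. *)
by exists 0, 0; rewrite (flatmx0 B) !mulmx0.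
Qed.

(** Since [v *m u] is the scalar [\tr A], [A *m A = \tr A *: A]. If the trace vanishes, symmetry
    gives [A *m A^T = 0], whose diagonal entries are the sums of squares of the rows of [A]. *)
Lemma sym_rank1_tr_neq0 (F : realFieldType) n (A : 'M[F]_n)
    (u : 'cV_n) (v : 'rV_n) :
  A = u *m v -> A^T = A -> A != 0 -> \tr A != 0.
Proof.
move=> Auv symA; apply: contraNneq => trA0.
have /matrixP A20 : A *m A^T = 0.
  rewrite symA Auv mulmxA -[u *m v *m u]mulmxA.
  rewrite [v *m u]mx11_scalar -trace_mx11 mxtrace_mulC -Auv trA0.
  by rewrite mul_mx_scalar scale0r mul0mx.
apply/eqP/matrixP=> i j; rewrite mxE.
have := A20 i i; rewrite !mxE => /eqP.
rewrite psumr_eq0; last by move=> l _; rewrite mxE -expr2 sqr_ge0.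
by move/allP/(_ j (mem_index_enum _)); rewrite mxE mulf_eq0 orbb => /eqP.
Qed.

(** * The reduced Laplacian of a central configuration *)

Section CentralConfiguration.
Variables (R : realType) (m : 'I_4 -> R) (r : 'I_4 -> 'rV[R]_2) (wsq : R).
Local Notation alpha := (alpha_perp m r wsq).
Local Notation ell := (reduced_laplacian m r wsq).

Lemma euclidean_norm_sqr (v : 'rV[R]_2) :
  euclidean_norm v ^+ 2 = v 0 0 ^+ 2 + v 0 1 ^+ 2.
Proof.
rewrite sqr_sqrtr; last by apply: sumr_ge0 => k _; apply: sqr_ge0.
rewrite !big_ord_recl big_ord0 addr0; congr (_ + v 0 _ ^+ 2).
exact: val_inj.
Qed.

Lemma distC i j : dist r i j = dist r j i.
Proof.
rewrite /dist /euclidean_norm; congr (Num.sqrt _).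
by apply: eq_bigr => k _; rewrite !mxE -sqrrN opprB.
Qed.

Lemma dist_gt0 : injective r -> forall i j, i != j -> 0 < dist r i j.
Proof.
move=> r_inj i j; apply: contraNT.
rewrite -leNgt le_eqVlt ltNge sqrtr_ge0 orbF => /eqP d0.
apply/eqP/r_inj/rowP => k.
have /eqP := euclidean_norm_sqr (r i - r j); rewrite -/(dist r i j) d0 expr0n /=.
rewrite eq_sym paddr_eq0 ?sqr_ge0 // !sqrf_eq0 !mxE !subr_eq0.
case/andP=> /eqP x0 /eqP x1; case: k => [[|[|//]] ltk].
- by rewrite (_ : Ordinal ltk = 0) //; apply: val_inj.
- by rewrite (_ : Ordinal ltk = 1) //; apply: val_inj.
Qed.

Lemma alpha_perpC i j : alpha i j = alpha j i.
Proof. by rewrite /alpha_perp /reduced_mass distC [m i * _]mulrC. Qed.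

Lemma total_mass_gt0 : (forall i, 0 < m i) -> 0 < total_mass m.
Proof.
move=> m_gt0; rewrite /total_mass big_ord_recl ltr_pwDl //.
by apply: sumr_ge0 => i _; apply: ltW.
Qed.

(** The [wsq] part of the weights sums to [(wsq * m i) *: r i] because the center of mass is at the
    origin; the inverse-cube part sums to the same vector by centrality. *)
Lemma sum_alpha_perp : (forall i, 0 < m i) -> \sum_i m i *: r i = 0 ->
  central_configuration m r wsq ->
  forall i, \sum_j alpha i j *: (r i - r j) = 0.
Proof.
move=> m_gt0 com [_ cc] i.
have M_neq0 : total_mass m != 0 by rewrite gt_eqF ?total_mass_gt0.
have split_alpha j : alpha i j *: (r i - r j) =
    (wsq * m i / total_mass m) *: (m j *: r i - m j *: r j)
    - (m i * m j / dist r i j ^+ 3) *: (r i - r j).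
  rewrite -scalerBr scalerA -scalerBl; congr (_ *: _).
  (* The distance is 0 at [j = i]; with its inverse cube made opaque, [field] only needs the total
     mass to be nonzero. *)
  by rewrite /alpha_perp /reduced_mass; move: (_ ^- 3) => c; field.
under eq_bigr do rewrite split_alpha.
rewrite sumrB -scaler_sumr sumrB -scaler_suml com subr0 scalerA divfK //.
by rewrite cc [X in _ - X](bigD1 i) //= subrr scaler0 add0r subrr.
Qed.

Lemma reduced_laplacian_sym : ell^T = ell.
Proof.
apply/matrixP=> i j; rewrite !mxE eq_sym; case: eqVneq => [-> //|_] /=.
by rewrite alpha_perpC.
Qed.

Definition relative_positions : 'M[R]_(3, 2) :=
  \matrix_i (r (lift ord0 i) - r ord0).

(** Measuring positions from body 1 makes the deleted column of the full Laplacian contribute zero,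
    so each row of the product is a sum of [sum_alpha_perp]. *)
Lemma mul_reduced_laplacian : (forall i, 0 < m i) -> \sum_i m i *: r i = 0 ->
  central_configuration m r wsq -> ell *m relative_positions = 0.
Proof.
move=> m_gt0 com cc; apply/row_matrixP => i; rewrite row0.
rewrite row_mul mulmx_sum_row; set a := lift ord0 i.
rewrite -[RHS](sum_alpha_perp m_gt0 com cc a).
rewrite [RHS](bigD1 a) //= subrr scaler0 add0r.
transitivity (\sum_(k | k != a) alpha a k *: (r a - r ord0) -
              \sum_(k | k != a) alpha a k *: (r k - r ord0)); last first.
  rewrite -sumrB; apply: eq_bigr => k _.
  by rewrite -scalerBr; congr (_ *: _); rewrite opprB addrA subrK.
rewrite (bigD1 i) //= rowK !mxE eqxx -scaler_suml; congr (_ + _).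
rewrite big_mkcond [in RHS]big_mkcond [in RHS]big_ord_recl /= subrr scaler0.
rewrite add0r -sumrN; apply: eq_bigr => j _.
rewrite (inj_eq lift_inj) rowK !mxE [i == j]eq_sym.
by case: eqP => _ /=; rewrite ?oppr0 ?scaleNr.
Qed.

Lemma rank_relative_positions : ~ collinear r -> \rank relative_positions = 2.
Proof.
move=> ncol; apply/eqP; rewrite eqn_leq rank_leq_col ltnNge; apply/negP.
move/rank_le1P => [u [v Duv]]; apply: ncol.
have pos i : r (lift ord0 i) = r ord0 + u i 0 *: v.
  have := congr1 (row i) Duv; rewrite rowK row_mul [row i u]mx11_scalar.
  by rewrite mul_scalar_mx mxE => <-; rewrite addrC subrK.
(* If [v = 0], all bodies sit at body 1 and any nonzero direction will do. *)
exists (r ord0), (if v == 0 then const_mx 1 else v); split.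
  case: ifPn => // _; apply/eqP => /matrixP/(_ 0 0).
  by rewrite !mxE; apply/eqP/oner_neq0.
move=> i; case: (unliftP ord0 i) => [j|] ->; last by exists 0; rewrite scale0r addr0.
rewrite pos; case: eqP => [->|_]; last by exists (u j 0).
by exists 0; rewrite scaler0 scale0r.
Qed.

Lemma reduced_laplacian_rank1 : (forall i, 0 < m i) ->
  \sum_i m i *: r i = 0 -> central_configuration m r wsq -> ~ collinear r ->
  exists (u : 'cV_3) (v : 'rV_3), ell = u *m v.
Proof.
move=> m_gt0 com cc /rank_relative_positions rkD; apply: rank_le1P.
(* A zero product bounds the sum of the two ranks by the inner dimension 3. *)
have := mulmx0_rank_max (mul_reduced_laplacian m_gt0 com cc).
by rewrite rkD addn2.
Qed.

(** Off-diagonal entries give the weights among bodies 2, 3, 4; each diagonal entry then reduces to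
    the weight towards body 1. *)
Lemma reduced_laplacian_eq0 : ell = 0 -> forall i j, i != j -> alpha i j = 0.
Proof.
move=> /matrixP ell0.
have off i j : i != j -> alpha (lift ord0 i) (lift ord0 j) = 0.
  move=> ij; have := ell0 i j; rewrite !mxE (negPf ij) => /eqP.
  by rewrite oppr_eq0 => /eqP.
have diag i : alpha (lift ord0 i) ord0 = 0.
  have := ell0 i i; rewrite !mxE eqxx /= (bigD1 ord0) //= big1 ?addr0 // => k.
  case/andP; case: (unliftP ord0 k) => [j|] -> //.
  by rewrite (inj_eq lift_inj) eq_sym => /off.
move=> i j; case: (unliftP ord0 i) (unliftP ord0 j) => [i'|] -> [j'|] -> //.
- by rewrite (inj_eq lift_inj) => /off.
- by rewrite alpha_perpC.
Qed.

(* The Gram determinant of three vectors of the plane vanishes, while for the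
   edges at a vertex of a regular tetrahedron of side s it equals s^6 / 2. *)
Lemma not_equidistant (s : R) : 0 < s -> ~ forall i j, i != j -> dist r i j = s.
Proof.
move=> s_gt0 ds.
have eqs i j : i != j ->
    (r i 0 0 - r j 0 0) ^+ 2 + (r i 0 1 - r j 0 1) ^+ 2 = s ^+ 2.
  by move=> /ds <-; rewrite euclidean_norm_sqr !mxE.
have gram (a0 a1 b0 b1 c0 c1 : R) :
    a0 ^+ 2 + a1 ^+ 2 = s ^+ 2 -> b0 ^+ 2 + b1 ^+ 2 = s ^+ 2 ->
    c0 ^+ 2 + c1 ^+ 2 = s ^+ 2 ->
    (a0 - b0) ^+ 2 + (a1 - b1) ^+ 2 = s ^+ 2 ->
    (a0 - c0) ^+ 2 + (a1 - c1) ^+ 2 = s ^+ 2 ->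
    (b0 - c0) ^+ 2 + (b1 - c1) ^+ 2 = s ^+ 2 -> s ^+ 6 = 0.
  move=> aa bb cc ab ac bc.
  (* Law of cosines: equal sides determine the inner products. *)
  have pab : a0 * b0 + a1 * b1 = s ^+ 2 / 2 by lra.
  have pac : a0 * c0 + a1 * c1 = s ^+ 2 / 2 by lra.
  have pbc : b0 * c0 + b1 * c1 = s ^+ 2 / 2 by lra.
  have : (a0 ^+ 2 + a1 ^+ 2) * (b0 ^+ 2 + b1 ^+ 2) * (c0 ^+ 2 + c1 ^+ 2)
    + 2 * (a0 * b0 + a1 * b1) * (a0 * c0 + a1 * c1) * (b0 * c0 + b1 * c1)
    - (a0 ^+ 2 + a1 ^+ 2) * (b0 * c0 + b1 * c1) ^+ 2
    - (b0 ^+ 2 + b1 ^+ 2) * (a0 * c0 + a1 * c1) ^+ 2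
    - (c0 ^+ 2 + c1 ^+ 2) * (a0 * b0 + a1 * b1) ^+ 2 = 0 by ring.
  rewrite aa bb cc pab pac pbc => gram0.
  by rewrite -[RHS](mulr0 2) -gram0; field.
suff s60 : s ^+ 6 = 0 by have := exprn_gt0 6 s_gt0; rewrite s60 ltxx.
apply: (gram (r 1 0 0 - r 0 0 0) (r 1 0 1 - r 0 0 1)
             (r 2 0 0 - r 0 0 0) (r 2 0 1 - r 0 0 1)
             (r 3 0 0 - r 0 0 0) (r 3 0 1 - r 0 0 1));
  by rewrite ?opprB ?subrKA eqs.
Qed.

(** Vanishing weights would make every cubed distance equal to [total_mass m / wsq], hence all
    distances equal. *)
Lemma reduced_laplacian_neq0 : (forall i, 0 < m i) -> injective r ->
  0 < wsq -> ell != 0.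
Proof.
move=> m_gt0 r_inj w_gt0; apply/eqP => /reduced_laplacian_eq0 alpha0.
have cube i j : i != j -> dist r i j ^+ 3 = total_mass m / wsq.
  move=> ij; have := alpha0 i j ij; rewrite /alpha_perp => /eqP.
  have M_gt0 := total_mass_gt0 m_gt0.
  have d3_gt0 : 0 < dist r i j ^+ 3 by rewrite exprn_gt0 // dist_gt0.
  rewrite mulf_eq0 gt_eqF /=; last by rewrite /reduced_mass !mulr_gt0 // invr_gt0.
  rewrite subr_eq0 => /eqP ->.
  by rewrite invf_div mulrC divfK // gt_eqF.
have pos01 : 0 < dist r 0 1 by apply: dist_gt0.
apply: (not_equidistant pos01) => i j ij.
have ge0 k l : 0 <= dist r k l by apply: sqrtr_ge0.
by apply: (@pexpIrn R 3); rewrite ?nnegrE ?cube.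
Qed.

Lemma tr_reduced_laplacian : \tr ell =
  alpha 0 1 + alpha 0 2 + alpha 0 3 + 2 * (alpha 1 2 + alpha 1 3 + alpha 2 3).
Proof.
have l0 : lift ord0 0 = 1 :> 'I_4 by apply: val_inj.
have l1 : lift ord0 1 = 2 :> 'I_4 by apply: val_inj.
have l2 : lift ord0 2 = 3 :> 'I_4 by apply: val_inj.
have sum4 (F : 'I_4 -> R) : \sum_i F i = F 0 + F 1 + F 2 + F 3.
  by rewrite !big_ord_recl big_ord0 addr0 !addrA; congr (F _ + F _ + F _ + F _);
    apply: val_inj.
have sum3 (F : 'I_3 -> R) : \sum_i F i = F 0 + F 1 + F 2.
  by rewrite !big_ord_recl big_ord0 addr0 !addrA; congr (F _ + F _ + F _);
    apply: val_inj.
have sum4D a (F : 'I_4 -> R) :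
    \sum_(k | k != a) F k = \sum_k if k != a then F k else 0.
  by rewrite big_mkcond.
rewrite /mxtrace sum3 !mxE !eqxx /= l0 l1 l2 !sum4D !sum4.
rewrite /= (alpha_perpC 1 0) (alpha_perpC 2 0) (alpha_perpC 3 0).
rewrite (alpha_perpC 2 1) (alpha_perpC 3 1) (alpha_perpC 3 2).
by ring.
Qed.

End CentralConfiguration.

(** * The spectrum of the tensor product *)

Theorem corollary5p2 (R : realType) (m : 'I_4 -> R) (r : 'I_4 -> 'rV[R]_2)
    (wsq : R)
    (m_gt0 : forall i, 0 < m i)
    (r_distinct : injective r)
    (center_of_mass : \sum_i m i *: r i = 0)
    (r_central : central_configuration m r wsq)
    (r_noncollinear : ~ collinear r) :
  let alpha := alpha_perp m r wsq in
  let ell := reduced_laplacian m r wsq in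
  let Lt : 'M[R]_(3 * 2) := ell *t (1%:M : 'M[R]_2) in
  let tau := \tr ell in
  [/\ tau = alpha 0 1 + alpha 0 2 + alpha 0 3
            + 2 * (alpha 1 2 + alpha 1 3 + alpha 2 3),
      [seq z <- spectrum Lt | z != 0] = [:: tau%:C; tau%:C]
    & perm_eq (spectrum Lt) [:: tau%:C; tau%:C; 0; 0; 0; 0]].
Proof.
move=> alpha ell Lt tau.
have [u [v ellE]] :=
  reduced_laplacian_rank1 m_gt0 center_of_mass r_central r_noncollinear.
have tau_neq0 : tau != 0.
  apply: (sym_rank1_tr_neq0 ellE (reduced_laplacian_sym _ _ _)).
  exact: reduced_laplacian_neq0 m_gt0 r_distinct r_central.1.
have char_Lt : char_poly Lt = ('X - tau%:P) ^+ 2 * 'X^4.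
  (* Restore the factor ['X^2], so that the exponent becomes [3 * 2]. *)
  apply: (@mulIf _ 'X^2); first by rewrite monic_neq0 // monicXn.
  rewrite -mulrA -exprD /Lt /tau /ell ellE.
  exact: (char_poly_rank1_tens1 2 u v).
have spec : perm_eq (spectrum Lt) [:: tau%:C; tau%:C; 0; 0; 0; 0].
  apply/prod_XsubC_eq; rewrite -spectrumP -map_char_poly char_Lt.
  rewrite rmorphM !rmorphXn rmorphB /= map_polyX map_polyC /=.
  by rewrite !big_cons big_nil subr0; ring.
split=> //; first exact: tr_reduced_laplacian.
have tauC_neq0 : tau%:C != 0 :> R[i] by rewrite fmorph_eq0.
have := perm_filter (fun z => z != 0) spec.
rewrite /= !eqxx tauC_neq0 /= => permT.
(* A permutation of a constant list is that list, which upgrades [perm_eq] to equality. *)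
have /all_pred1P : all (pred1 tau%:C) [seq z <- spectrum Lt | z != 0].
  by rewrite (perm_all _ permT) /= eqxx.
by rewrite (perm_size permT).
Qed.
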